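(* Let $G$ be a finite group and $A$ a finite set of size $q\geq 2$. Let $\tau \in \mathrm{CA}(G;A)$. Then $\tau$ is vN-regular if and only if for every $y \in (A^G)\tau$ there is $x \in A^G$ such that $(x)\tau = y$ and $G_x = G_y$.
   Context: Functions are applied on the right, and composition is read left to right: $\tau\sigma$ means first $\tau$, then $\sigma$. For a group $G$ and a set $A$, $A^G$ is the set of all functions $x: G\to A$; $G$ acts on $A^G$ by $(h)(x\cdot g) := (hg^{-1})x$ for $g,h\in G$, $x\in A^G$. A cellular automaton over $A^G$ is a map $\tau : A^G \to A^G$ for which there exist a finite subset $S \subseteq G$ (a memory set) and a function $\mu : A^S \to A$ (a local function) such that $(g)(x)\tau = ((x\cdot g^{-1})|_S)\mu$ for all $x\in A^G$, $g\in G$. $\mathrm{CA}(G;A)$ is the monoid of all cellular automata over $A^G$ under composition. $(A^G)\tau$ denotes the image of $\tau$. The stabiliser of $x \in A^G$ is $G_x := \{g\in G : x\cdot g = x\}$. An element $\tau\in \mathrm{CA}(G;A)$ is vN-regular (von Neumann regular) if there exists $\sigma\in \mathrm{CA}(G;A)$ with $\tau\sigma\tau=\tau$. *)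

(* Defs.v *)
From HB Require Import structures.
From mathcomp Require Import all_boot all_fingroup.

Set Implicit Arguments.
Unset Strict Implicit.
Unset Printing Implicit Defensive.

Import GroupScope.

Section CellularAutomata.

Variables (G : finGroupType) (A : finType).

(* The set A^G; since G is finite, {ffun _ -> _} makes it a finType on which
   Leibniz equality is extensional. *)
Definition config := {ffun G -> A}.

Definition shift (x : config) (g : G) : config := [ffun h => x (h * g^-1)].

Lemma shift1 x : shift x 1 = x.
Proof. by apply/ffunP => h; rewrite ffunE invg1 mulg1. Qed.

Lemma shiftM x : act_morph shift x.
Proof. by move=> g h; apply/ffunP => k; rewrite !ffunE invMg mulgA. Qed.

(* MathComp actions are right actions, so the stabiliser of x under shift is
   'C[x | shift_action]. *)
Definition shift_action : {action G &-> config} := TotalAction shift1 shiftM.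

Definition restr (S : {set G}) (x : config) : {ffun {h : G | h \in S} -> A} :=
  [ffun s => x (val s)].

Definition cellular_automaton (tau : config -> config) : Prop :=
  exists (S : {set G}) (mu : {ffun {h : G | h \in S} -> A} -> A),
    forall (x : config) (g : G), tau x g = mu (restr S (shift x g^-1)).

(* The monoid of cellular automata is the predicate cellular_automaton on
   self-maps of config, compared pointwise.  Composing on the left or on the
   right gives the same condition, the word tau sigma tau being a palindrome. *)
Definition vN_regular (tau : config -> config) : Prop :=
  exists sigma : config -> config,
    cellular_automaton sigma /\ tau \o sigma \o tau =1 tau.

End CellularAutomata.

Arguments shift_action : clear implicits.

(* Main.v *)
(* For finite G, the cellular automata over A^G are exactly the G-equivariant
   self-maps of A^G.  A quasi-inverse sigma of tau sends y in the image of tau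
   to an equivariantly chosen preimage; by equivariance of tau and sigma the two
   stabilisers coincide.  Conversely, sigma is built orbit by orbit: send a
   representative r to a preimage with stabiliser G_r, and extend by
   equivariance, which is well defined because the stabilisers match. *)
Require Import Defs.
From mathcomp Require Import all_boot all_fingroup.

Section EquivariantMaps.

Local Open Scope group_scope.

Lemma orbit_representative (aT : finGroupType) (T : finType)
    (to : {action aT &-> T}) :
  exists r : T -> T,
    (forall y, exists g, to (r y) g = y) /\ (forall y k, r (to y k) = r y).
Proof.
pose O y := orbit to setT y.
have OP y : exists z, z \in O y by exists y; apply: orbit_refl.
(* [xchoose] depends only on the extension of its predicate, hence only on the orbit. *)
exists (fun y => xchoose (OP y)); split=> [y | y k].
  have := xchooseP (OP y); rewrite orbit_sym => /orbitP[g _ gE].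
  by exists g.
by apply: eq_xchoose => z; rewrite /O orbit_act ?inE.
Qed.

Lemma equivariant_extension (aT : finGroupType) (T T' : finType)
    (to : {action aT &-> T}) (to' : {action aT &-> T'}) (f : T -> T') :
    (forall r, 'C[r | to] \subset 'C[f r | to']) ->
  exists s : T -> T',
    (forall y k, s (to y k) = to' (s y) k) /\
    (forall y, exists r g, y = to r g /\ s y = to' (f r) g).
Proof.
move=> sCf; have [r [/fin_all_exists[g rg] rE]] := orbit_representative _ _ to.
exists (fun y => to' (f (r y)) (g y)); split=> [y k | y]; last first.
  by exists (r y), (g y); rewrite rg.
rewrite rE -actM.
(* Both [g (to y k)] and [g y * k] carry [r y] to [to y k], so they differ by a stabiliser
   element. *)
have /(subsetP (sCf (r y)))/astab1P fix_f :
    g (to y k) * (g y * k)^-1 \in 'C[r y | to].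
  have gE : to (r y) (g (to y k)) = to (r y) (g y * k).
    by rewrite -{1}(rE y k) rg actM rg.
  by apply/astab1P; rewrite actM gE actK.
by rewrite -[in RHS]fix_f -actM mulgKV.
Qed.

Lemma cellular_automatonP (G : finGroupType) (A : finType)
    (tau : config G A -> config G A) :
  cellular_automaton tau <->
  (forall x k, tau (shift x k) = shift (tau x) k).
Proof.
split=> [[S [mu tauE]] x k | tau_eqv].
  by apply/ffunP => g; rewrite ffunE !tauE -shiftM invMg invgK.
pose ext (z : {ffun {h : G | h \in [set: G]} -> A}) : config G A :=
  [ffun h => z (exist _ h (in_setT h))].
(* With all of [G] as memory set the local function sees the whole configuration; equivariance
   recovers every value from the one at 1. *)
exists [set: G], (fun z => tau (ext z) 1) => x g.
have -> : ext (restr setT (shift x g^-1)) = shift x g^-1.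
  by apply/ffunP => h; rewrite !ffunE.
by rewrite tau_eqv ffunE invgK mul1g.
Qed.

Lemma sub_astab1_equivariant (aT : finGroupType) (T T' : finType)
    (to : {action aT &-> T}) (to' : {action aT &-> T'}) (f : T -> T') x :
  (forall x k, f (to x k) = to' (f x) k) -> 'C[x | to] \subset 'C[f x | to'].
Proof.
move=> f_eqv; apply/subsetP => k /astab1P fix_x.
by apply/astab1P; rewrite -f_eqv fix_x.
Qed.

End EquivariantMaps.

Theorem theorem4 (G : finGroupType) (A : finType) (q : nat)
    (cardA : #|A| = q) (q_ge2 : (2 <= q)%N)
    (tau : config G A -> config G A) (tauCA : cellular_automaton tau) :
  vN_regular tau <->
  (forall y : config G A, y \in codom tau ->
     exists x : config G A,
       tau x = y /\ ('C[x | shift_action G A] = 'C[y | shift_action G A])%g).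
Proof.
have tau_eqv := (cellular_automatonP _ _ tau).1 tauCA.
split=> [[sigma [/cellular_automatonP sigma_eqv tauK]] _ /codomP[x0 ->] | preim].
  (* Equivariant maps can only enlarge stabilisers; [sigma] gives one inclusion, and [tau], leading
     back to [tau x0], the other. *)
  exists (sigma (tau x0)); have tauKx := tauK x0; split=> //.
  apply/eqP; rewrite eqEsubset (sub_astab1_equivariant _ _ _ _ _ sigma (tau x0)) //.
  by rewrite -{2}tauKx (sub_astab1_equivariant _ _ _ _ _ tau).
(* Off the image the default is [y] itself, so that the inclusion of stabilisers holds
   everywhere. *)
have /fin_all_exists[f fP] (y : config G A) : exists x,
    (y \in codom tau -> tau x = y) /\
    ('C[y | shift_action G A] \subset 'C[x | shift_action G A])%g.
  have [/preim[x [tx Cx]] | _] := boolP (y \in codom tau); last by exists y.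
  by exists x; rewrite Cx.
have [sigma [sigma_eqv sigmaP]] :=
  equivariant_extension _ _ _ _ _ f (fun r => (fP r).2).
exists sigma; split=> [|x /=]; first exact/cellular_automatonP.
have [r [g [txE ->]]] := sigmaP (tau x).
(* The image of [tau] is closed under shifts, so it contains the representative of the orbit of
   [tau x]. *)
have r_codom : r \in codom tau.
  apply/codomP; exists (shift x g^-1%g); rewrite tau_eqv txE.
  by rewrite -[shift _ _]/(shift_action G A _ _) actK.
by rewrite txE -{2}((fP r).1 r_codom); apply: tau_eqv.
Qed.
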